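(* For every finite connected weighted graph $G=(V,E,w)$ with $|V|=n\ge2$ and $w:E\to\mathbb{R}_{>0}$, $$\frac{\operatorname{OPT}_D(G,w)}{\operatorname{OPT}_{\mathrm{free}}(G,w)}\le\frac{2(n+1)}{3}.$$ The factor is best possible and is attained by the unweighted complete graph $K_n$ (all edge weights equal to $1$).
   Context: $d_G$ is the shortest-path metric of the support graph $(V,E)$ with every edge of length $1$; the weights are not edge lengths. An ultrametric on $V$ is a metric $u$ with $u(x,y)\le\max\{u(x,z),u(z,y)\}$ for all $x,y,z$. $\operatorname{OPT}_{\mathrm{free}}(G,w)$ is the minimum of $\sum_{xy\in E}w_{xy}u(x,y)$ over all ultrametrics $u$ on $V$ with $u(x,y)\ge d_G(x,y)$ for all $x,y\in V$ (the minimum is attained). A rooted binary hierarchy $T$ on $V$ is a rooted tree whose leaves are the vertices of $V$ and whose internal nodes have exactly two children; each node is identified with the set of leaves below it (a cluster), and $C_T(x,y)$ is the cluster of the lowest common ancestor of $x,y$. $\operatorname{OPT}_D(G,w)$ is the minimum of the standard Dasgupta cost $\sum_{xy\in E}w_{xy}|C_T(x,y)|$ over all rooted binary hierarchies $T$ on $V$. *)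

(* Defs.v *)
From HB Require Import structures.
From mathcomp Require Import all_boot all_order all_algebra.
From mathcomp Require Import classical_sets reals.

Set Implicit Arguments.
Unset Strict Implicit.
Unset Printing Implicit Defensive.

Import Order.TTheory GRing.Theory Num.Theory.
Local Open Scope ring_scope.

(* The value [wt x y] is meaningful only when [adj x y]. *)
Record wgraph (R : realType) (V : finType) := WGraph {
  adj : rel V;
  wt : V -> V -> R;
  adj_sym : symmetric adj;
  adj_irr : irreflexive adj;
  adj_connected : forall x y : V, connect adj x y;
  wt_sym : forall x y : V, adj x y -> wt x y = wt y x;
  wt_gt0 : forall x y : V, adj x y -> 0 < wt x y
}.

Definition has_walk (V : finType) (e : rel V) (x y : V) (k : nat) : bool :=
  [exists p : k.-tuple V, path e x p && (last x p == y)].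

Lemma ex_walk (R : realType) (V : finType) (G : wgraph R V) (x y : V) :
  exists k, has_walk (adj G) x y k.
Proof.
have /connectP[p pth ->] := adj_connected G x y.
by exists (size p); apply/existsP; exists (in_tuple p); rewrite pth eqxx.
Qed.

Definition gdist (R : realType) (V : finType) (G : wgraph R V) (x y : V) : nat :=
  ex_minn (ex_walk G x y).

(* The sum over ordered adjacent pairs counts every edge twice; [f] is only
   ever applied to functions that are symmetric. *)
Definition edge_sum (R : realType) (V : finType) (G : wgraph R V)
    (f : V -> V -> R) : R :=
  (\sum_(x : V) \sum_(y : V | adj G x y) wt G x y * f x y) / 2.

Definition is_metric (R : realType) (V : Type) (u : V -> V -> R) : Prop :=
  [/\ forall x y, 0 <= u x y,
      forall x y, u x y = 0 <-> x = y,
      forall x y, u x y = u y x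
    & forall x y z, u x y <= u x z + u z y].

Definition is_ultrametric (R : realType) (V : Type) (u : V -> V -> R) : Prop :=
  is_metric u /\ forall x y z, u x y <= Num.max (u x z) (u z y).

Definition dominates (R : realType) (V : finType) (G : wgraph R V)
    (u : V -> V -> R) : Prop :=
  forall x y, (gdist G x y)%:R <= u x y.

(* For nonempty [V] the set of costs is nonempty and bounded below by 0, and
   its infimum is attained, so that [inf] is the minimum; likewise for
   [OPT_D]. *)
Definition OPT_free (R : realType) (V : finType) (G : wgraph R V) : R :=
  inf [set edge_sum G u | u in
        [set u : V -> V -> R | is_ultrametric u /\ dominates G u]]%classic.

(* Children are ordered here; no definition below depends on the order. *)
Inductive btree (V : Type) : Type :=
| Leaf of V
| Node of btree V & btree V.

Fixpoint leaves (V : Type) (t : btree V) : seq V :=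
  match t with
  | Leaf x => [:: x]
  | Node l r => leaves l ++ leaves r
  end.

Definition is_hierarchy (V : finType) (t : btree V) : Prop :=
  perm_eq (leaves t) (enum V).

Definition cluster (V : finType) (t : btree V) : {set V} :=
  [set x in leaves t].

(* For leaves [x] and [y] of [t], the cluster of their lowest common ancestor:
   descend from the root as long as one child contains both. *)
Fixpoint lca_cluster (V : finType) (t : btree V) (x y : V) : {set V} :=
  match t with
  | Leaf _ => cluster t
  | Node l r =>
      if (x \in cluster l) && (y \in cluster l) then lca_cluster l x y
      else if (x \in cluster r) && (y \in cluster r) then lca_cluster r x y
      else cluster t
  end.

Definition dasgupta_cost (R : realType) (V : finType) (G : wgraph R V)
    (t : btree V) : R :=
  edge_sum G (fun x y => #|lca_cluster t x y|%:R).

Definition OPT_D (R : realType) (V : finType) (G : wgraph R V) : R :=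
  inf [set dasgupta_cost G t | t in
        [set t : btree V | is_hierarchy t]]%classic.

Section Complete.
Variables (R : realType) (V : finType).

Let cadj : rel V := fun x y => x != y.
Let cwt : V -> V -> R := fun _ _ => 1.

Lemma complete_sym : symmetric cadj.
Proof. by move=> x y; rewrite /cadj eq_sym. Qed.

Lemma complete_irr : irreflexive cadj.
Proof. by move=> x; rewrite /cadj eqxx. Qed.

Lemma complete_connected (x y : V) : connect cadj x y.
Proof. by have [->|xy] := eqVneq x y; [exact: connect0 | exact: connect1]. Qed.

Lemma complete_wt_sym (x y : V) : cadj x y -> cwt x y = cwt y x.
Proof. by []. Qed.

Lemma complete_wt_gt0 (x y : V) : cadj x y -> 0 < cwt x y.
Proof. by move=> _; exact: ltr01. Qed.

Definition complete_graph : wgraph R V :=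
  WGraph complete_sym complete_irr complete_connected
         complete_wt_sym complete_wt_gt0.

End Complete.

(* Main.v *)
Require Import Defs.
From HB Require Import structures.
From mathcomp Require Import all_boot all_order all_algebra.
From mathcomp Require Import classical_sets reals.
From mathcomp Require Import all_fingroup.
From mathcomp Require Import zify lra.

Set Implicit Arguments.
Unset Strict Implicit.
Unset Printing Implicit Defensive.

Import Order.TTheory GRing.Theory Num.Theory.
Local Open Scope ring_scope.

(** An ultrametric dominating the graph distance is at least 1 on every edge, so
    [OPT_free] is at least the total weight [W].  On the other hand, every
    hierarchy has the same cost [(n ^ 3 - n) / 3] on the complete graph; placing
    the vertices on the leaves of a fixed hierarchy by a uniformly random
    permutation therefore gives each edge an expected cluster size of
    [((n ^ 3 - n) / 3) / 'C(n, 2) = 2 * (n + 1) / 3], whence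
    [OPT_D <= 2 * (n + 1) / 3 * W].  For the complete graph both bounds are
    equalities. *)

(** * Averaging over permutations *)

(** The first transposition sends [x] to [a]; the second sends the current image of [y] to [b] and
    fixes [a], since [a] differs from both points it moves. *)
Lemma exists_perm2 (V : finType) (x y a b : V) : x != y -> a != b ->
  exists p : {perm V}, p x = a /\ p y = b.
Proof.
move=> xy ab; exists (tperm x a * tperm (tperm x a y) b)%g.
rewrite !permM tpermL; split; last by rewrite tpermL.
rewrite tpermD // 1?eq_sym //.
by rewrite -{1}[a](tpermL x) (inj_eq perm_inj).
Qed.

(** By double transitivity the sum over [s] depends only on [x] and [y] being distinct. Keeping the
    sum over [a] and [b] on the left avoids dividing by the number of pairs. *)
Lemma sum_perm_pair (R : comPzRingType) (V : finType) (f : V -> V -> R)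
    (x y : V) : x != y ->
  \sum_(a : V) \sum_(b | a != b) \sum_(s : {perm V}) f (s x) (s y)
    = #|{perm V}|%:R * \sum_(a : V) \sum_(b | a != b) f a b.
Proof.
move=> xy.
transitivity
  (\sum_(a : V) \sum_(b | a != b) \sum_(s : {perm V}) f (s a) (s b)).
  apply: eq_bigr => a _; apply: eq_bigr => b ab.
  have [p [<- <-]] := exists_perm2 xy ab.
  rewrite (reindex_inj (mulgI p)) /=.
  by apply: eq_bigr => s _; rewrite !permM.
rewrite (eq_bigr (fun a =>
  \sum_(s : {perm V}) \sum_(b | a != b) f (s a) (s b))); last first.
  by move=> a _; rewrite exchange_big.
rewrite exchange_big /= mulr_natl -sumr_const.
(* Each fixed [s] permutes the ordered pairs of distinct points. *)
apply: eq_bigr => s _; rewrite [RHS](reindex_inj (@perm_inj _ s)) /=.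
apply: eq_bigr => a _; rewrite [RHS](reindex_inj (@perm_inj _ s)) /=.
by apply: eq_bigl => b; rewrite (inj_eq perm_inj).
Qed.

(** * Relabelling the leaves of a hierarchy *)

Fixpoint map_btree (V W : Type) (f : V -> W) (t : btree V) : btree W :=
  match t with
  | Leaf x => Leaf (f x)
  | Node l r => Node (map_btree f l) (map_btree f r)
  end.

Lemma leaves_map_btree (V W : Type) (f : V -> W) (t : btree V) :
  leaves (map_btree f t) = map f (leaves t).
Proof. by elim: t => //= l -> r ->; rewrite map_cat. Qed.

Lemma cluster_map_btree (V W : finType) (f : V -> W) (t : btree V) :
  cluster (map_btree f t) = f @: cluster t.
Proof.
apply/setP => z; rewrite inE leaves_map_btree.
apply/mapP/imsetP => -[x xt ->]; exists x => //; move: xt; by rewrite inE.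
Qed.

(** Injectivity keeps the outcome of every membership test, so both descents follow the same
    path. *)
Lemma lca_cluster_map_btree (V W : finType) (f : V -> W) (t : btree V)
    (x y : V) : injective f ->
  lca_cluster (map_btree f t) (f x) (f y) = f @: lca_cluster t x y.
Proof.
move=> finj; elim: t => [z|l IHl r IHr]; first exact: (cluster_map_btree f (Leaf z)).
rewrite [LHS]/= [in RHS]/= !cluster_map_btree !(mem_imset _ _ finj) IHl IHr.
do 2![case: ifP => _ //]; exact: (cluster_map_btree f (Node l r)).
Qed.

Lemma is_hierarchy_perm (V : finType) (t : btree V) (s : {perm V}) :
  is_hierarchy t -> is_hierarchy (map_btree s t).
Proof.
rewrite /is_hierarchy leaves_map_btree => ht.
apply: uniq_perm; last 2 [exact: enum_uniq].
  by rewrite (map_inj_uniq perm_inj) (perm_uniq ht) enum_uniq.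
move=> z; rewrite mem_enum -(permKV s z) mem_map; last exact: perm_inj.
by rewrite (perm_mem ht) mem_enum.
Qed.

Lemma exists_hierarchy (V : finType) : (0 < #|V|)%N ->
  exists t : btree V, is_hierarchy t.
Proof.
rewrite cardE /is_hierarchy; case: (enum V) => // x s _.
suff [t <-] : exists t, leaves t = x :: s by exists t.
elim: s x => [|y s IH] x; first by exists (Leaf x).
by have [t ht] := IH y; exists (Node (Leaf x) t); rewrite /= ht.
Qed.

(** * Cluster sizes summed over pairs of leaves *)

Lemma card_cluster (V : finType) (t : btree V) :
  uniq (leaves t) -> #|cluster t| = size (leaves t).
Proof. by move=> ut; rewrite cardsE; apply/card_uniqP. Qed.

Lemma lca_cluster_same (V : finType) (t : btree V) (x : V) :
  x \in leaves t -> lca_cluster t x x = [set x].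
Proof.
elim: t => [z|l IHl r IHr] /=.
  by rewrite inE => /eqP ->; apply/setP => y; rewrite !inE.
by rewrite mem_cat !andbb !inE; case: ifP => [/IHl //|_ /= xr]; rewrite xr IHr.
Qed.

(** If the children have [a] and [b] leaves, the pairs they separate contribute [2ab(a + b)] in
    total, and [2(a + b)^3 + (a + b)] exceeds [(2a^3 + a) + (2b^3 + b)] by three times that. The
    factor 3 keeps the identity in the naturals. *)
Lemma sum_lca_cluster (V : finType) (t : btree V) : uniq (leaves t) ->
  (3 * \sum_(x <- leaves t) \sum_(y <- leaves t) #|lca_cluster t x y|
    = 2 * size (leaves t) ^ 3 + size (leaves t))%N.
Proof.
elim: t => [z|l IHl r IHr] ut.
  by rewrite /= !big_seq1 card_cluster.
have ct := card_cluster ut.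
have /and3P[ul /hasPn lr ur] : [&& uniq (leaves l),
    ~~ has (mem (leaves l)) (leaves r) & uniq (leaves r)].
  by rewrite -cat_uniq.
have rl x : x \in leaves r -> (x \in leaves l) = false by move/lr/negbTE.
have lr' x : x \in leaves l -> (x \in leaves r) = false.
  by move=> xl; apply/negP => /lr /=; rewrite xl.
pose F x y := #|lca_cluster (Node l r) x y|.
have csum (s1 s2 : seq V) c :
  (\sum_(x <- s1) \sum_(y <- s2) c = size s1 * size s2 * c)%N.
  by rewrite !big_const_seq !iter_addn_0 !count_predT; lia.
have ll : (\sum_(x <- leaves l) \sum_(y <- leaves l) F x y
   = \sum_(x <- leaves l) \sum_(y <- leaves l) #|lca_cluster l x y|)%N.
  apply: eq_big_seq => x xl; apply: eq_big_seq => y yl.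
  by rewrite /F /= !inE xl yl.
have rr : (\sum_(x <- leaves r) \sum_(y <- leaves r) F x y
   = \sum_(x <- leaves r) \sum_(y <- leaves r) #|lca_cluster r x y|)%N.
  apply: eq_big_seq => x xl; apply: eq_big_seq => y yl.
  by rewrite /F /= !inE xl yl (rl x).
have lrE : (\sum_(x <- leaves l) \sum_(y <- leaves r) F x y
   = \sum_(x <- leaves l) \sum_(y <- leaves r) #|cluster (Node l r)|)%N.
  apply: eq_big_seq => x xl; apply: eq_big_seq => y yl.
  by rewrite /F /= !inE (rl y) // (lr' x) // andbF.
have rlE : (\sum_(x <- leaves r) \sum_(y <- leaves l) F x y
   = \sum_(x <- leaves r) \sum_(y <- leaves l) #|cluster (Node l r)|)%N.
  apply: eq_big_seq => x xl; apply: eq_big_seq => y yl.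
  by rewrite /F /= !inE (rl x) // (lr' y) // andbF.
have splitF s : (\sum_(x <- s) \sum_(y <- leaves (Node l r)) F x y
    = \sum_(x <- s) \sum_(y <- leaves l) F x y
      + \sum_(x <- s) \sum_(y <- leaves r) F x y)%N.
  by rewrite -big_split; apply: eq_bigr => x _; rewrite big_cat.
rewrite -/F big_cat !splitF ll lrE rlE rr !csum ct /= size_cat.
move: (IHl ul) (IHr ur); rewrite !expnS !expn0.
set A := (\sum_(x <- leaves l) _)%N; set B := (\sum_(x <- leaves r) _)%N.
set a := size _; set b := size _.
move: A B a b => A B a b; nia.
Qed.

Lemma sum_lca_cluster_pairs (R : realType) (V : finType) (t : btree V) :
  is_hierarchy t ->
  \sum_(x : V) \sum_(y | x != y) #|lca_cluster t x y|%:R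
    = 2 * (#|V|%:R + 1) / 3 * (#|V|%:R * (#|V|%:R - 1)) :> R.
Proof.
move=> ht; have ut : uniq (leaves t) by rewrite (perm_uniq ht) enum_uniq.
have /(congr1 (fun k => k%:R : R)) := sum_lca_cluster ut.
rewrite (perm_size ht) -cardE (perm_big _ ht) big_enum /=.
(* Each diagonal pair has a singleton cluster; removing these [n] ones from [(2n^3 + n) / 3] leaves
   [2(n + 1) / 3] times the number of ordered pairs. *)
rewrite (eq_bigr (fun x => 1 + \sum_(y | x != y) #|lca_cluster t x y|))%N.
  rewrite big_split /= sum1_card !(natrM, natrD, natrX).
  rewrite natr_sum; under eq_bigr do rewrite natr_sum.
  by move=> e; lra.
move=> x _; rewrite (perm_big _ ht) big_enum /= (bigD1 x) //=.
rewrite lca_cluster_same ?cards1; last by rewrite (perm_mem ht) mem_enum.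
by congr addn; apply: eq_bigl => y; rewrite eq_sym.
Qed.

(** * Edge sums, distances and bounds on the two optima *)

Section EdgeSum.
Variables (R : realType) (V : finType) (G : wgraph R V).
Implicit Types f g : V -> V -> R.

Definition total_weight : R := edge_sum G (fun _ _ => 1).

(** The diagonal is exempt because [adj] is irreflexive. *)
Lemma eq_edge_sum f g :
  (forall x y, x != y -> f x y = g x y) -> edge_sum G f = edge_sum G g.
Proof.
move=> fg; congr (_ / _); apply: eq_bigr => x _; apply: eq_bigr => y xy.
by rewrite fg //; apply: contraTneq xy => ->; rewrite adj_irr.
Qed.

Lemma le_edge_sum f g :
  (forall x y, adj G x y -> f x y <= g x y) -> edge_sum G f <= edge_sum G g.
Proof.
move=> fg; rewrite /edge_sum ler_pM2r ?invr_gt0 ?ltr0n //.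
apply: ler_sum => x _; apply: ler_sum => y xy.
by rewrite ler_pM2l ?fg // wt_gt0.
Qed.

Lemma edge_sum_ge0 f :
  (forall x y, adj G x y -> 0 <= f x y) -> 0 <= edge_sum G f.
Proof.
move=> f0; apply: divr_ge0 => //; apply: sumr_ge0 => x _.
by apply: sumr_ge0 => y xy; rewrite mulr_ge0 ?f0 // ltW // wt_gt0.
Qed.

Lemma edge_sum_const (c : R) : edge_sum G (fun _ _ => c) = c * total_weight.
Proof.
rewrite /total_weight /edge_sum mulrA; congr (_ / _).
rewrite mulr_sumr; apply: eq_bigr => x _; rewrite mulr_sumr.
by apply: eq_bigr => y _; rewrite mulr1 mulrC.
Qed.

Lemma edge_sum_sum (I : finType) (F : I -> V -> V -> R) :
  \sum_i edge_sum G (F i) = edge_sum G (fun x y => \sum_i F i x y).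
Proof.
rewrite -mulr_suml; congr (_ / _).
rewrite exchange_big /=; apply: eq_bigr => x _.
rewrite exchange_big /=; apply: eq_bigr => y _.
by rewrite mulr_sumr.
Qed.

Lemma gdist_gt0 (x y : V) : x != y -> (0 < gdist G x y)%N.
Proof.
move=> xy; rewrite /gdist; case: ex_minnP => -[|//] /existsP[p] /andP[_].
by rewrite (tuple0 p) /= (negbTE xy).
Qed.

Lemma gdistxx (x : V) : gdist G x x = 0%N.
Proof.
rewrite /gdist; case: ex_minnP => m _ /(_ 0%N) min_m.
apply/eqP; rewrite -leqn0 min_m //.
by apply/existsP; exists [tuple]; rewrite /= eqxx.
Qed.

Lemma gdist_adj (x y : V) : adj G x y -> (gdist G x y <= 1)%N.
Proof.
move=> xy; rewrite /gdist; case: ex_minnP => m _; apply.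
by apply/existsP; exists [tuple y]; rewrite /= xy eqxx.
Qed.

(** A source of feasible ultrametrics: a large [c] works for any graph, and [c = 1] is optimal for
    the complete graph. *)
Definition uniform_metric (c : R) (x y : V) : R := if x == y then 0 else c.

Lemma uniform_metric_ultra (c : R) :
  0 < c -> is_ultrametric (uniform_metric c).
Proof.
move=> c0; have c0' := ltW c0.
have um x y z :
    uniform_metric c x y <= Num.max (uniform_metric c x z) (uniform_metric c z y).
  rewrite /uniform_metric le_max.
  have [->|xz] := eqVneq x z; first by rewrite lexx orbT.
  by case: ifP; rewrite ?c0' ?lexx.
have ge0 x y : 0 <= uniform_metric c x y.
  by rewrite /uniform_metric; case: ifP.
split=> //; split=> // [x y|x y|x y z].
- rewrite /uniform_metric; case: eqVneq => // xy; split=> [c00|/eqP].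
    by rewrite c00 ltxx in c0.
  by rewrite (negbTE xy).
- by rewrite /uniform_metric eq_sym.
- apply: le_trans (um x y z) _; rewrite ge_max lerDl lerDr !ge0 //.
Qed.

Lemma uniform_metric_dominates (c : R) :
  (forall x y, x != y -> (gdist G x y)%:R <= c) ->
  dominates G (uniform_metric c).
Proof.
move=> hc x y; rewrite /uniform_metric; case: eqVneq => [->|/hc //].
by rewrite gdistxx.
Qed.

Lemma OPT_free_le (u : V -> V -> R) :
  is_ultrametric u -> dominates G u -> OPT_free G <= edge_sum G u.
Proof.
move=> uu du; apply: ge_inf; last by exists u.
exists 0 => _ [v [[[v0 _ _ _] _] _] <-].
by apply: edge_sum_ge0 => x y _; apply: v0.
Qed.

Lemma total_weight_le_OPT_free : total_weight <= OPT_free G.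
Proof.
apply: lb_le_inf.
  (* The infimum needs a nonempty set. The sum of all distances bounds each of them, and the
     successor keeps [c] positive even if every distance is 0. *)
  pose c : nat := (\sum_(x : V) \sum_(y : V) gdist G x y).+1.
  exists (edge_sum G (uniform_metric c%:R)), (uniform_metric c%:R) => //.
  split; first by apply: uniform_metric_ultra; rewrite ltr0n.
  apply: uniform_metric_dominates => x y _; rewrite ler_nat /c.
  rewrite (bigD1 x) //= (bigD1 y) //=; lia.
move=> _ [u [uu du] <-]; apply: le_edge_sum => x y xy.
apply: le_trans (du x y); rewrite ler1n gdist_gt0 //.
by apply: contraTneq xy => ->; rewrite adj_irr.
Qed.

Lemma OPT_D_le (t : btree V) : is_hierarchy t -> OPT_D G <= dasgupta_cost G t.
Proof.
move=> ht; apply: ge_inf; last by exists t.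
by exists 0 => _ [t' _ <-]; apply: edge_sum_ge0.
Qed.

Lemma OPT_D_le_total_weight : (2 <= #|V|)%N ->
  OPT_D G <= 2 * (#|V|%:R + 1) / 3 * total_weight.
Proof.
move=> V2; have [t ht] := exists_hierarchy (ltnW V2).
set K := 2 * _ / 3.
have perm_gt0 : 0 < #|{perm V}|%:R :> R.
  by rewrite ltr0n; apply/card_gt0P; exists 1%g.
(* The expected cluster size of a randomly relabelled pair is [K], written without division. *)
have avg x y : x != y ->
    \sum_(s : {perm V}) #|lca_cluster t (s x) (s y)|%:R
      = #|{perm V}|%:R * K :> R.
  move=> xy.
  have := sum_perm_pair (fun a b => #|lca_cluster t a b|%:R : R) xy.
  rewrite sum_lca_cluster_pairs // -/K.
  rewrite (eq_bigr (fun=> (\sum_(s : {perm V})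
    #|lca_cluster t (s x) (s y)|%:R : R) *+ #|V|.-1)); last first.
    move=> a _; rewrite sumr_const; congr (_ *+ _).
    by rewrite -(cardC1 a); apply: eq_card => b; rewrite !inE eq_sym.
  rewrite sumr_const -mulrnA -[X in X = _ -> _]mulr_natl natrM.
  rewrite -subn1 natrB ?(ltnW V2) // [_ * #|V|%:R]mulrC => e.
  (* The number of ordered pairs of distinct vertices is nonzero because [n >= 2], so it can be
     cancelled. *)
  have n0 : #|V|%:R * (#|V|%:R - 1) != 0 :> R.
    by rewrite mulf_neq0 ?subr_eq0 ?pnatr_eq0 ?pnatr_eq1 //; lia.
  by apply: (mulfI n0); rewrite e mulrA mulrC.
rewrite -(ler_pM2l perm_gt0) mulr_natl -sumr_const.
(* Relabelling by the inverse of [s] makes the cluster of [x] and [y] as large as the cluster of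
   [s x] and [s y] in [t], the form summed in [avg]. *)
apply: (@le_trans _ _ (\sum_(s : {perm V}) dasgupta_cost G (map_btree s^-1%g t))).
  by apply: ler_sum => s _; apply/OPT_D_le/is_hierarchy_perm.
rewrite /dasgupta_cost edge_sum_sum mulrA -edge_sum_const.
rewrite le_eqVlt; apply/orP; left; apply/eqP.
apply: eq_edge_sum => x y xy; rewrite -(avg _ _ xy); apply: eq_bigr => s _.
rewrite -{1}(permK s x) -{1}(permK s y).
by rewrite lca_cluster_map_btree ?card_imset //; exact: perm_inj.
Qed.

End EdgeSum.

(** * The complete graph *)

Lemma edge_sum_complete (R : realType) (V : finType) (f : V -> V -> R) :
  edge_sum (complete_graph R V) f = (\sum_(x : V) \sum_(y | x != y) f x y) / 2.
Proof.
congr (_ / _); apply: eq_bigr => x _; apply: eq_bigr => y _.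
by rewrite /= mul1r.
Qed.

Lemma total_weight_complete (R : realType) (V : finType) : (0 < #|V|)%N ->
  total_weight (complete_graph R V) = #|V|%:R * (#|V|%:R - 1) / 2.
Proof.
move=> V0; rewrite /total_weight edge_sum_complete; congr (_ / _).
rewrite (eq_bigr (fun=> #|V|%:R - 1)) ?sumr_const ?mulr_natl // => x _.
rewrite sumr_const -(natrB _ V0) subn1 -(cardC1 x); congr (_%:R).
by apply: eq_card => y; rewrite !inE eq_sym.
Qed.

(** Distinct vertices are at distance at most 1, so [uniform_metric 1] is feasible and meets the
    lower bound. *)
Lemma OPT_free_complete (R : realType) (V : finType) :
  OPT_free (complete_graph R V) = total_weight (complete_graph R V).
Proof.
apply: le_anti; rewrite total_weight_le_OPT_free andbT.
rewrite /total_weight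
  (@eq_edge_sum _ _ _ (fun _ _ => 1) (uniform_metric 1)); last first.
  by move=> x y /negbTE xy; rewrite /uniform_metric xy.
apply: OPT_free_le; first exact: uniform_metric_ultra.
by apply: uniform_metric_dominates => x y xy; rewrite lern1 gdist_adj.
Qed.

Lemma OPT_D_complete (R : realType) (V : finType) : (2 <= #|V|)%N ->
  OPT_D (complete_graph R V)
    = 2 * (#|V|%:R + 1) / 3 * total_weight (complete_graph R V).
Proof.
move=> V2; have V0 := ltnW V2.
apply: le_anti; rewrite OPT_D_le_total_weight //=.
apply: lb_le_inf.
  have [t ht] := exists_hierarchy V0.
  by exists (dasgupta_cost (complete_graph R V) t), t.
(* Every hierarchy has the same cost, so the common value is itself a lower bound. *)
move=> _ [t ht <-]; rewrite /dasgupta_cost edge_sum_complete.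
by rewrite sum_lca_cluster_pairs // total_weight_complete // mulrA.
Qed.

Theorem corollary8 (R : realType) (n : nat) (hn : (2 <= n)%N) :
  [/\ (* the upper bound *)
      forall (V : finType) (G : wgraph R V), #|V| = n ->
        OPT_D G / OPT_free G <= 2 * (n%:R + 1) / 3,
      (* it is attained by the unweighted complete graph *)
      forall V : finType, #|V| = n ->
        OPT_D (complete_graph R V) / OPT_free (complete_graph R V)
          = 2 * (n%:R + 1) / 3
    & (* no smaller factor works for graphs on n vertices *)
      forall c : R,
        (forall (V : finType) (G : wgraph R V), #|V| = n ->
           OPT_D G / OPT_free G <= c) ->
        2 * (n%:R + 1) / 3 <= c].
Proof.
have K0 : 0 <= 2 * (n%:R + 1) / 3 :> R.
  by rewrite divr_ge0 // mulr_ge0 // addr_ge0.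
have complete_ratio (V : finType) : #|V| = n ->
    OPT_D (complete_graph R V) / OPT_free (complete_graph R V)
      = 2 * (n%:R + 1) / 3.
  move=> Vn; rewrite OPT_D_complete ?Vn // OPT_free_complete mulfK //.
  rewrite total_weight_complete Vn ?(ltnW hn) //.
  by rewrite !mulf_neq0 ?subr_eq0 ?invr_eq0 ?pnatr_eq0 ?pnatr_eq1 //; lia.
split=> // [V G Vn|c hc].
- have W0 : 0 <= total_weight G by apply: edge_sum_ge0.
  have WF := total_weight_le_OPT_free G.
  (* Division by zero yields 0 here, and then [K0] gives the bound. *)
  have [->|F0] := eqVneq (OPT_free G) 0; first by rewrite invr0 mulr0.
  rewrite ler_pdivrMr; last by rewrite lt_def F0 (le_trans W0).
  apply: le_trans (OPT_D_le_total_weight G _) _; first by rewrite Vn.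
  by rewrite Vn ler_wpM2l.
(* The complete graph on ['I_n] forces [c] to be at least the claimed factor. *)
- by rewrite -(complete_ratio 'I_n) ?card_ord //; apply: hc; rewrite card_ord.
Qed.
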